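(* Let $\mathbf A=(A;\cdot,\to,\leadsto,1)$ be a pseudo-hoop and let $M\subseteq A$. Let $G=M^\perp\cdot M^{\perp\perp}=\{a\cdot b\mid a\in M^\perp,\ b\in M^{\perp\perp}\}$. If there is an element $x\in A$ with $x\notin G$ such that the set $\{a\in G\mid x\le a\}$ has a least element, then $\mathbf A$ is subdirectly reducible.
   Context: A pseudo-hoop is an algebra $(A;\cdot,\to,\leadsto,1)$ of type $\langle 2,2,2,0\rangle$ such that for all $x,y,z\in A$: $x\cdot 1=x=1\cdot x$; $x\to x=1=x\leadsto x$; $(x\cdot y)\to z=x\to(y\to z)$; $(x\cdot y)\leadsto z=y\leadsto(x\leadsto z)$; and $(x\to y)\cdot x=(y\to x)\cdot y=x\cdot(x\leadsto y)=y\cdot(y\leadsto x)$. Setting $x\le y$ iff $x\to y=1$ gives a partial order with greatest element $1$. For $x,y\in A$, ''$x\vee y=1$'' means that the supremum of $\{x,y\}$ exists and equals $1$. For $M\subseteq A$, $M^\perp=\{x\in A\mid x\vee y=1\text{ for every }y\in M\}$ and $M^{\perp\perp}=(M^\perp)^\perp$. An algebra is subdirectly reducible if it is not subdirectly irreducible, i.e. its identity congruence is the intersection of a family of congruences each different from the identity congruence (equivalently, it is a subdirect product of algebras none of whose projections is an isomorphism). *)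

(* Defs.v *)
Section PseudoHoop.
Context {A : Type} (mul imp limp : A -> A -> A) (one : A).

Definition is_pseudo_hoop : Prop :=
  (forall x, mul x one = x /\ mul one x = x) /\
  (forall x, imp x x = one /\ limp x x = one) /\
  (forall x y z, imp (mul x y) z = imp x (imp y z)) /\
  (forall x y z, limp (mul x y) z = limp y (limp x z)) /\
  (forall x y,
      mul (imp x y) x = mul (imp y x) y /\
      mul (imp y x) y = mul x (limp x y) /\
      mul x (limp x y) = mul y (limp y x)).

Definition ph_le (x y : A) : Prop := imp x y = one.

Definition is_sup (x y s : A) : Prop :=
  ph_le x s /\ ph_le y s /\ (forall z, ph_le x z -> ph_le y z -> ph_le s z).

Definition join_one (x y : A) : Prop := is_sup x y one.

Definition perp (M : A -> Prop) : A -> Prop :=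
  fun x => forall y, M y -> join_one x y.

Definition perp_prod (M : A -> Prop) : A -> Prop :=
  fun g => exists a b, perp M a /\ perp (perp M) b /\ g = mul a b.

Definition is_congruence (theta : A -> A -> Prop) : Prop :=
  (forall x, theta x x) /\
  (forall x y, theta x y -> theta y x) /\
  (forall x y z, theta x y -> theta y z -> theta x z) /\
  (forall x1 y1 x2 y2, theta x1 y1 -> theta x2 y2 ->
     theta (mul x1 x2) (mul y1 y2) /\
     theta (imp x1 x2) (imp y1 y2) /\
     theta (limp x1 x2) (limp y1 y2)).

Definition subdirectly_reducible : Prop :=
  exists (I : Type) (theta : I -> A -> A -> Prop),
    inhabited I /\
    (forall i, is_congruence (theta i)) /\
    (forall i, exists a b, theta i a b /\ a <> b) /\
    (forall a b, (forall i, theta i a b) -> a = b).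

End PseudoHoop.

(* Main.v *)
(** Write [m = a * b] with [a] in P = M^perp and [b] in Q = M^perp^perp, and put
    [z = m ~> x], so that [x = m * z].  If [f >= z] lies in P or Q, then [m * f]
    is an element of G above [x], so [m * f = m]; hence [f ~> z = z] and
    [f * z = z].  It follows that P ∩ ↑z is the set of common upper bounds of
    [a] and [z], and that this set is closed under products; the same holds for
    Q ∩ ↑z, with [b] for [a].  A set of common upper bounds of two elements that
    is closed under products is a normal filter, because its members fix both
    elements under multiplication on either side.  Neither filter is {1}, for
    otherwise [z], and with it [x = m * z], would lie in G.  They meet in {1}
    since P and Q are orthogonal. *)

From Stdlib Require Import Classical.
Require Import Defs.

Section PseudoHoopTheory.
Context {A : Type} {mul imp limp : A -> A -> A} {one : A}.
Context (HA : is_pseudo_hoop mul imp limp one).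

Local Infix "*" := mul.
Local Infix "==>" := imp (at level 55, right associativity).
Local Infix "~>" := limp (at level 55, right associativity).
Local Infix "<=" := (ph_le imp one).
Local Notation perp := (perp imp one).
Local Notation perp_prod := (perp_prod mul imp one).

(** * Order, residuation and monotonicity in a pseudo-hoop *)

Lemma mul_one_r x : x * one = x.
Proof. apply HA. Qed.

Lemma mul_one_l x : one * x = x.
Proof. apply HA. Qed.

Lemma imp_diag x : x ==> x = one.
Proof. apply HA. Qed.

Lemma limp_diag x : x ~> x = one.
Proof. apply HA. Qed.

Lemma imp_curry x y z : (x * y) ==> z = x ==> y ==> z.
Proof. apply HA. Qed.

Lemma limp_curry x y z : (x * y) ~> z = y ~> x ~> z.
Proof. apply HA. Qed.

Lemma meet_imp_comm x y : (x ==> y) * x = (y ==> x) * y.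
Proof. apply HA. Qed.

Lemma meet_limp_comm x y : x * (x ~> y) = y * (y ~> x).
Proof. apply HA. Qed.

Lemma meet_imp_limp x y : (x ==> y) * x = x * (x ~> y).
Proof. rewrite meet_imp_comm. apply HA. Qed.

Lemma le_refl x : x <= x.
Proof. apply imp_diag. Qed.

Lemma le_antisym x y : x <= y -> y <= x -> x = y.
Proof.
  unfold ph_le; intros Hxy Hyx.
  rewrite <- (mul_one_l x), <- Hxy, meet_imp_comm, Hyx. apply mul_one_l.
Qed.

(* Associativity is not an axiom: it is forced by currying and antisymmetry. *)
Lemma mul_assoc x y z : x * (y * z) = x * y * z.
Proof.
  assert (E : forall w, (x * (y * z)) ==> w = (x * y * z) ==> w).
  { intro w. now rewrite !imp_curry. }
  apply le_antisym; unfold ph_le; rewrite E || rewrite <- E; apply imp_diag.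
Qed.

(** With [v = x ==> one], the element [one ==> x] is [v * x], and [x <= v * x]. Hence [x = (v * x
    ==> x) * (v * x) = (v ==> one) * v * x = v * x]. *)
Lemma one_imp x : one ==> x = x.
Proof.
  set (v := x ==> one).
  assert (Hu : one ==> x = v * x).
  { unfold v. rewrite meet_imp_comm. symmetry. apply mul_one_r. }
  assert (Hv : (v ==> one) * v = v).
  { rewrite meet_imp_comm, mul_one_r. unfold v.
    now rewrite <- imp_curry, mul_one_l. }
  assert (Hxu : x ==> v * x = one).
  { rewrite <- Hu, <- imp_curry, mul_one_r. apply imp_diag. }
  generalize (meet_imp_comm x (v * x)).
  rewrite Hxu, mul_one_l, imp_curry, imp_diag, mul_assoc, Hv, <- Hu. auto.
Qed.

Lemma le_one x : x <= one.
Proof.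
  assert (E : (x ==> one) * x = x) by now rewrite meet_imp_comm, mul_one_r, one_imp.
  unfold ph_le. rewrite <- E at 1. rewrite imp_curry. apply imp_diag.
Qed.

Lemma imp_mul_le x y : (x ==> y) * x <= y.
Proof. unfold ph_le. rewrite imp_curry. apply imp_diag. Qed.

Lemma meet_of_le x y : x <= y -> (y ==> x) * y = x.
Proof. intro H. rewrite meet_imp_comm, H. apply mul_one_l. Qed.

Lemma le_trans x y z : x <= y -> y <= z -> x <= z.
Proof.
  intros Hxy Hyz. rewrite <- (meet_of_le _ _ Hxy). unfold ph_le.
  rewrite imp_curry, Hyz. apply le_one.
Qed.

Lemma le_imp x y z : x * y <= z <-> x <= y ==> z.
Proof. unfold ph_le. now rewrite imp_curry. Qed.

(** Both arrows induce the same order because [(x ==> y) * x] and [x * (x ~> y)] coincide. *)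
Lemma le_limp_one x y : x <= y <-> x ~> y = one.
Proof.
  split; intro H.
  - assert (E : x = x * (x ~> y)).
    { now rewrite <- meet_imp_limp, H, mul_one_l. }
    rewrite E, limp_curry at 1. apply limp_diag.
  - assert (E : x * (x ~> y) = x) by now rewrite H, mul_one_r.
    rewrite <- E, <- meet_imp_limp. apply imp_mul_le.
Qed.

Lemma le_limp x y z : x * y <= z <-> y <= x ~> z.
Proof. now rewrite !le_limp_one, limp_curry. Qed.

Lemma mul_le_compat x x' y y' : x <= x' -> y <= y' -> x * y <= x' * y'.
Proof.
  intros Hx Hy. apply le_trans with (x' * y).
  - apply le_imp, le_trans with x'; [assumption|]. apply le_imp, le_refl.
  - apply le_limp, le_trans with y'; [assumption|]. apply le_limp, le_refl.
Qed.

Lemma mul_le_l x y : x * y <= x.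
Proof.
  rewrite <- (mul_one_r x) at 2. apply mul_le_compat; [apply le_refl|apply le_one].
Qed.

Lemma mul_le_r x y : x * y <= y.
Proof.
  rewrite <- (mul_one_l y) at 2. apply mul_le_compat; [apply le_one|apply le_refl].
Qed.

Lemma mul_limp_le x y : x * (x ~> y) <= y.
Proof. apply le_limp, le_refl. Qed.

Lemma mul_limp_of_le x y : x <= y -> y * (y ~> x) = x.
Proof. intro H. now rewrite <- meet_imp_limp, meet_of_le. Qed.

Lemma one_of_le x : one <= x -> x = one.
Proof. intro H. apply le_antisym; [apply le_one|assumption]. Qed.

(** * Orthogonal elements and polars *)

Lemma join_one_iff x y :
  join_one imp one x y <-> forall h, x <= h -> y <= h -> h = one.
Proof.
  split.
  - intros (_ & _ & H) h Hx Hy. now apply one_of_le, H.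
  - intro H. repeat split; try apply le_one.
    intros h Hx Hy. rewrite (H h Hx Hy). apply le_refl.
Qed.

Lemma join_one_sym x y : join_one imp one x y -> join_one imp one y x.
Proof. rewrite !join_one_iff. auto. Qed.

(** The element [(y ==> x) ~> x] lies above both [x] and [y], so it is [one]. *)
Lemma imp_of_join_one x y : join_one imp one x y -> y ==> x = x.
Proof.
  rewrite join_one_iff. intro H. apply le_antisym.
  - apply le_limp_one, H.
    + apply le_limp, mul_le_r.
    + apply le_limp, imp_mul_le.
  - apply le_imp, mul_le_l.
Qed.

Lemma mul_comm_of_join_one x y : join_one imp one x y -> x * y = y * x.
Proof.
  intro H. rewrite <- (imp_of_join_one _ _ H) at 1.
  rewrite meet_imp_comm. f_equal. now apply imp_of_join_one, join_one_sym.
Qed.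

Lemma perp_up (M : A -> Prop) x y : perp M x -> x <= y -> perp M y.
Proof.
  intros Hx Hxy u Hu. apply join_one_iff. intros h Hyh Huh.
  apply (proj1 (join_one_iff x u) (Hx u Hu)); [|assumption].
  now apply le_trans with y.
Qed.

(** If [h] lies above [x * y] and [u], then [y ==> h] lies above [x] and [u], so it is [one]. Thus
    [y <= h], and [h = one] follows from [y] and [u]. *)
Lemma perp_mul (M : A -> Prop) x y : perp M x -> perp M y -> perp M (x * y).
Proof.
  intros Hx Hy u Hu. apply join_one_iff. intros h Hh Huh.
  apply (proj1 (join_one_iff y u) (Hy u Hu)); [|assumption].
  apply (proj1 (join_one_iff x u) (Hx u Hu)).
  - now apply le_imp.
  - apply le_trans with h; [assumption|]. apply le_imp, mul_le_l.
Qed.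

(** * Product-closed sets of common upper bounds *)

Definition common_upper_bound (c p f : A) : Prop := c <= f /\ p <= f.

Definition mul_closed (F : A -> Prop) : Prop :=
  forall f g, F f -> F g -> F (f * g).

(* All common upper bounds [f] below [j = (p ~> c) ==> c], itself a common upper
   bound, have the same residual [f ~> c]; comparing [f] with [f * f] gives
   [c = f * f * (f ~> c) = f * c]. *)
Lemma common_upper_bound_mul_l c p f :
  mul_closed (common_upper_bound c p) -> common_upper_bound c p f -> f * c = c.
Proof.
  intros Hcl. set (q := p ~> c). set (j := q ==> c).
  assert (Hj : common_upper_bound c p j).
  { split; apply le_imp; [apply mul_le_l|apply mul_limp_le]. }
  assert (Hres : forall g, common_upper_bound c p g -> g <= j -> g * q = c).
  { intros g [Hcg Hpg] Hgj.
    enough (E : g ~> c = q) by now rewrite <- E; apply mul_limp_of_le.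
    apply le_antisym; apply le_limp.
    - apply le_trans with (g * (g ~> c)); [|apply mul_limp_le].
      apply mul_le_compat; [assumption|apply le_refl].
    - now apply le_imp. }
  assert (Hbelow : forall g, common_upper_bound c p g -> g <= j -> g * c = c).
  { intros g Hg Hgj. rewrite <- (Hres g Hg Hgj) at 1. rewrite mul_assoc.
    apply Hres; [now apply Hcl|].
    apply le_trans with g; [apply mul_le_l|assumption]. }
  intro Hf. apply le_antisym; [apply mul_le_r|].
  rewrite <- (Hbelow (f * j)) at 1.
  - apply mul_le_compat; [apply mul_le_l|apply le_refl].
  - now apply Hcl.
  - apply mul_le_r.
Qed.

(** Mirror image of the previous argument: each common upper bound [g] below [j = (p ==> c) ~> c]
    satisfies [(p ==> c) * g = c], and a general [f] is replaced by [j * f]. *)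
Lemma common_upper_bound_mul_r c p f :
  mul_closed (common_upper_bound c p) -> common_upper_bound c p f -> c * f = c.
Proof.
  intros Hcl. set (q := p ==> c). set (j := q ~> c).
  assert (Hj : common_upper_bound c p j).
  { split; apply le_limp; [apply mul_le_r|apply imp_mul_le]. }
  assert (Hres : forall g, common_upper_bound c p g -> g <= j -> q * g = c).
  { intros g [Hcg Hpg] Hgj.
    enough (E : g ==> c = q) by now rewrite <- E; apply meet_of_le.
    apply le_antisym; apply le_imp.
    - apply le_trans with ((g ==> c) * g); [|apply imp_mul_le].
      apply mul_le_compat; [apply le_refl|assumption].
    - now apply le_limp. }
  assert (Hbelow : forall g, common_upper_bound c p g -> g <= j -> c * g = c).
  { intros g Hg Hgj. rewrite <- (Hres g Hg Hgj) at 1. rewrite <- mul_assoc.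
    apply Hres; [now apply Hcl|].
    apply le_trans with g; [apply mul_le_l|assumption]. }
  intro Hf. apply le_antisym; [apply mul_le_l|].
  rewrite <- (Hbelow (j * f)) at 1.
  - apply mul_le_compat; [apply le_refl|apply mul_le_r].
  - now apply Hcl.
  - apply mul_le_l.
Qed.

(** * Normal filters, their congruences and subdirect decompositions *)

Record normal_filter (F : A -> Prop) : Prop := {
  filter_one : F one;
  filter_mul : mul_closed F;
  filter_conj_l : forall f y, F f -> exists2 g, F g & g * y <= y * f;
  filter_conj_r : forall f y, F f -> exists2 g, F g & y * g <= f * y
}.

Lemma common_upper_bound_sym c p f :
  common_upper_bound c p f <-> common_upper_bound p c f.
Proof. unfold common_upper_bound. tauto. Qed.

Lemma common_upper_bound_normal c p :
  mul_closed (common_upper_bound c p) -> normal_filter (common_upper_bound c p).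
Proof.
  intro Hcl.
  assert (Hcl' : mul_closed (common_upper_bound p c)).
  { intros f g. rewrite !(common_upper_bound_sym p c). apply Hcl. }
  (* The product [y * e] lies below [e * (e ~> y)], which equals [f * (e * (e ~> y))] because [f]
     fixes [e]. *)
  assert (Hl : forall e f y, f * e = e -> y * e <= f * y).
  { intros e f y E. apply le_trans with (e * (e ~> y)).
    - rewrite meet_limp_comm. apply mul_le_compat; [apply le_refl|].
      apply le_limp, mul_le_r.
    - rewrite <- E at 1. rewrite <- mul_assoc.
      apply mul_le_compat; [apply le_refl|apply mul_limp_le]. }
  assert (Hr : forall e f y, e * f = e -> e * y <= y * f).
  { intros e f y E. apply le_trans with ((e ==> y) * e).
    - rewrite meet_imp_comm. apply mul_le_compat; [|apply le_refl].
      apply le_imp, mul_le_l.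
    - rewrite <- E at 2. rewrite mul_assoc.
      apply mul_le_compat; [apply imp_mul_le|apply le_refl]. }
  split.
  - split; apply le_one.
  - exact Hcl.
  (* The residual is the largest [g] with [g * y <= y * f]; [Hr] places [c] and [p] below it. *)
  - intros f y Hf. exists (y ==> y * f); [|apply imp_mul_le].
    split; apply le_imp, Hr.
    + now apply common_upper_bound_mul_r with p.
    + apply common_upper_bound_mul_r with c; [assumption|].
      now apply common_upper_bound_sym.
  - intros f y Hf. exists (y ~> f * y); [|apply mul_limp_le].
    split; apply le_limp, Hl.
    + now apply common_upper_bound_mul_l with p.
    + apply common_upper_bound_mul_l with c; [assumption|].
      now apply common_upper_bound_sym.
Qed.

(** By residuation, some member of [F] lies below both [x ==> y] and [y ==> x]. *)
Definition filter_congruence (F : A -> Prop) (x y : A) : Prop :=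
  exists f, F f /\ f * x <= y /\ f * y <= x.

Lemma filter_le_mul F f g x1 y1 x2 y2 :
  normal_filter F -> F f -> F g -> f * x1 <= y1 -> g * x2 <= y2 ->
  exists2 h, F h & h * (x1 * x2) <= y1 * y2.
Proof.
  intros HF Hf Hg H1 H2.
  destruct (filter_conj_l F HF g x1 Hg) as [g' Hg' Hc].
  exists (f * g'); [now apply HF|].
  apply le_trans with (f * x1 * (g * x2)); [|now apply mul_le_compat].
  rewrite !mul_assoc. apply mul_le_compat; [|apply le_refl].
  rewrite <- !mul_assoc. apply mul_le_compat; [apply le_refl|assumption].
Qed.

Lemma filter_le_imp F f g x1 y1 x2 y2 :
  normal_filter F -> F f -> F g -> f * y1 <= x1 -> g * x2 <= y2 ->
  exists2 h, F h & h * (x1 ==> x2) <= y1 ==> y2.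
Proof.
  intros HF Hf Hg H1 H2.
  (* Normality carries [f] across the arrow, next to [y1], where [f * y1 <= x1] applies. *)
  destruct (filter_conj_l F HF f (x1 ==> x2) Hf) as [f' Hf' Hc].
  exists (g * f'); [now apply HF|]. apply -> le_imp.
  apply le_trans with (g * x2); [|assumption].
  rewrite <- !mul_assoc. apply mul_le_compat; [apply le_refl|].
  apply le_trans with ((x1 ==> x2) * x1); [|apply imp_mul_le].
  apply le_trans with ((x1 ==> x2) * (f * y1)).
  - rewrite !mul_assoc. now apply mul_le_compat; [|apply le_refl].
  - now apply mul_le_compat; [apply le_refl|].
Qed.

Lemma filter_le_limp F f g x1 y1 x2 y2 :
  normal_filter F -> F f -> F g -> f * y1 <= x1 -> g * x2 <= y2 ->
  exists2 h, F h & h * (x1 ~> x2) <= y1 ~> y2.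
Proof.
  intros HF Hf Hg H1 H2.
  destruct (filter_conj_r F HF f y1 Hf) as [f' Hf' Hcf].
  destruct (filter_conj_r F HF g y1 Hg) as [g' Hg' Hcg].
  exists (g' * f'); [now apply HF|]. apply -> le_limp.
  apply le_trans with (g * x2); [|assumption].
  apply le_trans with (g * (y1 * f' * (x1 ~> x2))).
  - rewrite !mul_assoc. apply mul_le_compat; [|apply le_refl].
    now apply mul_le_compat; [|apply le_refl].
  - apply mul_le_compat; [apply le_refl|].
    apply le_trans with (x1 * (x1 ~> x2)); [|apply mul_limp_le].
    apply mul_le_compat; [|apply le_refl]. now apply le_trans with (f * y1).
Qed.

Lemma filter_congruence_intro F x y :
  normal_filter F ->
  (exists2 f, F f & f * x <= y) -> (exists2 g, F g & g * y <= x) ->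
  filter_congruence F x y.
Proof.
  intros HF [f Hf H1] [g Hg H2]. exists (f * g).
  split; [now apply HF|split].
  - apply le_trans with (f * x); [|assumption].
    apply mul_le_compat; [apply mul_le_l|apply le_refl].
  - apply le_trans with (g * y); [|assumption].
    apply mul_le_compat; [apply mul_le_r|apply le_refl].
Qed.

Lemma filter_congruence_correct F :
  normal_filter F -> is_congruence mul imp limp (filter_congruence F).
Proof.
  intro HF. repeat apply conj.
  - intro x. exists one. split; [apply HF|split]; apply mul_le_r.
  - intros x y (f & Hf & H1 & H2). now exists f.
  - intros x y z (f & Hf & Hxy & Hyx) (g & Hg & Hyz & Hzy).
    apply filter_congruence_intro; [assumption| |].
    + exists (g * f); [now apply HF|]. rewrite <- mul_assoc.
      apply le_trans with (g * y); [|assumption].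
      now apply mul_le_compat; [apply le_refl|].
    + exists (f * g); [now apply HF|]. rewrite <- mul_assoc.
      apply le_trans with (f * y); [|assumption].
      now apply mul_le_compat; [apply le_refl|].
  - intros x1 y1 x2 y2 (f & Hf & H1 & H1') (g & Hg & H2 & H2').
    split; [|split]; apply filter_congruence_intro; try assumption.
    + now apply filter_le_mul with f g.
    + now apply filter_le_mul with f g.
    + now apply filter_le_imp with f g.
    + now apply filter_le_imp with f g.
    + now apply filter_le_limp with f g.
    + now apply filter_le_limp with f g.
Qed.

(** If both congruences relate [x] and [y], members [f] of [F1] and [g] of [F2] lie below [x ==> y]
    and [y ==> x]. Their join is [one], so both arrows are [one]. *)
Lemma subdirectly_reducible_of_filters F1 F2 :
  normal_filter F1 -> normal_filter F2 ->
  (exists2 f, F1 f & f <> one) -> (exists2 f, F2 f & f <> one) ->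
  (forall f g, F1 f -> F2 g -> join_one imp one f g) ->
  subdirectly_reducible mul imp limp.
Proof.
  intros HF1 HF2 Hn1 Hn2 Hd.
  assert (Hnontriv : forall F, (exists2 f, F f & f <> one) ->
            exists a b, filter_congruence F a b /\ a <> b).
  { intros F [f Hf Hne]. exists f, one. split; [|assumption].
    exists f. split; [assumption|split]; [apply le_one|apply mul_le_l]. }
  exists bool, (fun i : bool => filter_congruence (if i then F1 else F2)).
  split; [exact (inhabits true)|]. split; [|split].
  - intros []; now apply filter_congruence_correct.
  - intros []; now apply Hnontriv.
  - intros x y H.
    destruct (H true) as (f & Hf & Hxy & Hyx).
    destruct (H false) as (g & Hg & Hxy' & Hyx').
    apply le_imp in Hxy, Hyx, Hxy', Hyx'.
    apply le_antisym; apply (proj1 (join_one_iff f g) (Hd f g Hf Hg)); assumption.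
Qed.

(** * Filters inside the two polars *)

(** Kept abstract in [P] and [Q] so that it serves each polar in turn, with the factors of [m]
    exchanged. *)
Lemma polar_filter (P Q : A -> Prop) x z a b :
  (forall f g, P f -> Q g -> join_one imp one f g) ->
  (forall f g, P f -> f <= g -> P g) ->
  mul_closed P ->
  P a -> Q b -> z = a * b ~> x -> x = a * b * z ->
  (forall f, P f -> x <= a * b * f -> a * b <= a * b * f) ->
  (forall f, common_upper_bound a z f -> P f) /\
  (forall f, P f -> z <= f -> common_upper_bound a z f) /\
  mul_closed (common_upper_bound a z).
Proof.
  intros Hpq Hup Hmul Ha Hb Hz Hx Hmin.
  assert (HP : forall f, common_upper_bound a z f -> P f).
  { intros f [Haf _]. now apply Hup with a. }
  assert (Hfix : forall f, P f -> z <= f -> a * b * f = a * b).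
  { intros f Hf Hzf. apply le_antisym; [apply mul_le_l|].
    apply Hmin; [assumption|]. rewrite Hx.
    apply mul_le_compat; [apply le_refl|assumption]. }
  assert (HU : forall f, P f -> z <= f -> common_upper_bound a z f).
  { intros f Hf Hzf. split; [|assumption].
    (* Orthogonality gives [b ==> f = f], so [a <= f] amounts to [a * b <= f], which follows from
       [a * b = a * b * f]. *)
    rewrite <- (imp_of_join_one f b) by now apply Hpq.
    apply le_imp. rewrite <- (Hfix f Hf Hzf). apply mul_le_r. }
  split; [assumption|split; [assumption|]].
  intros f g Hf Hg. apply HU; [apply Hmul; now apply HP|].
  assert (E : f * z = z).
  { assert (Hres : f ~> z = z).
    { rewrite Hz at 1. rewrite <- limp_curry, Hfix; [now symmetry|now apply HP|apply Hf]. }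
    rewrite <- Hres at 1. apply mul_limp_of_le, Hf. }
  rewrite <- E. apply mul_le_compat; [apply le_refl|apply Hg].
Qed.

(** Failure of [perp P z] yields some [h] other than [one] above [z] and above a member of [P];
    upward closure puts [h] in [P]. *)
Lemma common_upper_bound_nontrivial (P : A -> Prop) a z :
  (forall f g, P f -> f <= g -> P g) ->
  (forall f, P f -> z <= f -> common_upper_bound a z f) ->
  ~ perp P z -> exists2 f, common_upper_bound a z f & f <> one.
Proof.
  intros Hup HU Hnz. apply NNPP. intro Hno. apply Hnz. intros u Hu.
  apply join_one_iff. intros h Hzh Huh. apply NNPP. intro Hne. apply Hno.
  exists h; [|assumption]. apply HU; [|assumption]. now apply Hup with u.
Qed.

Lemma perp_triple M x : perp (perp (perp M)) x -> perp M x.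
Proof.
  intros H y Hy. apply H. intros u Hu. now apply join_one_sym, Hu.
Qed.

Lemma perp_prod_mul_r M m z :
  perp_prod M m -> perp M z \/ perp (perp M) z -> perp_prod M (m * z).
Proof.
  intros (a & b & Ha & Hb & ->) [Hz|Hz].
  (* Here [z] must move past [b]; orthogonal elements commute. *)
  - exists (a * z), b. split; [now apply perp_mul|split; [assumption|]].
    rewrite <- !mul_assoc. f_equal.
    now apply mul_comm_of_join_one, Hb.
  - exists a, (b * z). split; [assumption|split; [now apply perp_mul|]].
    now rewrite mul_assoc.
Qed.

Lemma subdirectly_reducible_of_least M x m :
  ~ perp_prod M x -> perp_prod M m -> x <= m ->
  (forall a, perp_prod M a -> x <= a -> m <= a) ->
  subdirectly_reducible mul imp limp.
Proof.
  intros HxG HmG Hxm Hmin.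
  set (z := m ~> x).
  assert (Hx : x = m * z) by now symmetry; apply mul_limp_of_le.
  assert (Hz : ~ (perp M z \/ perp (perp M) z)).
  { intro H. apply HxG. rewrite Hx. now apply perp_prod_mul_r. }
  assert (Hmin' : forall f, perp M f \/ perp (perp M) f ->
            x <= m * f -> m <= m * f).
  { intros f Hf. now apply Hmin, perp_prod_mul_r. }
  destruct HmG as (a & b & Ha & Hb & Em).
  (* Commuting the orthogonal factors makes the situation symmetric in the two polars. *)
  assert (Em' : m = b * a) by now rewrite Em; symmetry; apply mul_comm_of_join_one, Hb.
  assert (Hpq : forall f g, perp M f -> perp (perp M) g -> join_one imp one f g).
  { intros f g Hf Hg. now apply join_one_sym, Hg. }
  destruct (polar_filter (perp M) (perp (perp M)) x z a b)
    as (HP & HUP & HclP); try rewrite <- Em; auto.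
  { apply perp_up. }
  { exact (perp_mul M). }
  destruct (polar_filter (perp (perp M)) (perp M) x z b a)
    as (HQ & HUQ & HclQ); try rewrite <- Em'; auto.
  { apply perp_up. }
  { exact (perp_mul (perp M)). }
  apply subdirectly_reducible_of_filters
    with (common_upper_bound a z) (common_upper_bound b z).
  - now apply common_upper_bound_normal.
  - now apply common_upper_bound_normal.
  - apply common_upper_bound_nontrivial with (perp M); auto. apply perp_up.
  - apply common_upper_bound_nontrivial with (perp (perp M)); auto.
    { apply perp_up. }
    (* For the second polar, nontriviality concerns the triple polar of [M], which is contained in
       the first. *)
    intro H. apply Hz. left. now apply perp_triple.
  - auto.
Qed.

End PseudoHoopTheory.

Theorem theorem4p6 (A : Type) (mul imp limp : A -> A -> A) (one : A)
  (HA : is_pseudo_hoop mul imp limp one) (M : A -> Prop) :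
  (exists x : A, ~ perp_prod mul imp one M x /\
     exists m : A, perp_prod mul imp one M m /\ ph_le imp one x m /\
       (forall a, perp_prod mul imp one M a -> ph_le imp one x a ->
          ph_le imp one m a)) ->
  subdirectly_reducible mul imp limp.
Proof.
  intros (x & HxG & m & HmG & Hxm & Hmin).
  exact (subdirectly_reducible_of_least HA M x m HxG HmG Hxm Hmin).
Qed.
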